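(* Let $k$ be an algebraically closed field, $R$ a finitely generated commutative $k$-algebra, $M$ a Noetherian $R$-module, $x=(x_1,\ldots,x_n)$ an $n$-tuple in $R$, and $q=(q_1,\ldots,q_m)$ an $m$-tuple of polynomials in $k[X_1,\ldots,X_n]$, with $q(x)=(q_1(x),\ldots,q_m(x))$ and $q:k^n\to k^m$, $a\mapsto(q_1(a),\ldots,q_m(a))$. Then \[\sigma(q(x),M)=q(\sigma(x,M)).\]
   Context: For a commutative $k$-algebra $R$, an $R$-module $M$ and an $n$-tuple $y$ in $R$, the Koszul complex $\operatorname{Kos}(y,M)$ is $0\leftarrow M\leftarrow M\otimes_k\wedge^1k^n\leftarrow\cdots\leftarrow M\otimes_k\wedge^nk^n\leftarrow 0$ with differential $\partial(u\otimes e_{i_1}\wedge\cdots\wedge e_{i_p})=\sum_{s=1}^p(-1)^{s+1}y_{i_s}u\otimes e_{i_1}\wedge\cdots\wedge\widehat{e_{i_s}}\wedge\cdots\wedge e_{i_p}$. For $a\in k^n$, $y-a=(y_1-a_1,\ldots,y_n-a_n)$. The Taylor spectrum $\sigma(y,M)$ is the set of $a\in k^n$ such that $\operatorname{Kos}(y-a,M)$ is not exact. *)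

(* Defs.v *)
From HB Require Import structures.
From mathcomp Require Import all_boot all_order all_algebra.
From mathcomp Require Import mpoly.
Set Implicit Arguments. Unset Strict Implicit. Unset Printing Implicit Defensive.
Import Order.TTheory GRing.Theory.
Local Open Scope ring_scope.

Definition peval (k : fieldType) (R : comAlgType k) (n : nat)
  (x : 'I_n -> R) (p : {mpoly k[n]}) : R := mmap (in_alg R) x p.

Definition fg_algebra (k : fieldType) (R : comAlgType k) : Prop :=
  exists (N : nat) (g : 'I_N -> R), forall r : R,
    exists p : {mpoly k[N]}, r = peval g p.

Definition submodule (R : comNzRingType) (M : lmodType R) (S : M -> Prop) :=
  [/\ S 0, (forall u v, S u -> S v -> S (u + v)) &
      (forall (r : R) u, S u -> S (r *: u))].

Definition noetherian_module (R : comNzRingType) (M : lmodType R) : Prop :=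
  forall S : M -> Prop, submodule S ->
    exists s : seq M, forall u : M,
      S u <-> exists c : 'I_(size s) -> R, u = \sum_(i < size s) c i *: s`_i.

(* Koszul complex Kos(y,M): M (x) wedge^p k^n is identified with functions
   {set 'I_n} -> M supported on the p-element subsets I (coefficient of
   the basis vector e_I = e_{i_1} /\ ... /\ e_{i_p}, i_1 < ... < i_p).
   The differential  d(u e_I) = sum_s (-1)^(s+1) y_{i_s} u e_{I \ i_s}
   gives, coefficientwise,
     (d f)(J) = sum_{i notin J} (-1)^#{j in J | j < i} y_i f(J u {i}). *)
Definition koszul_chain (R : comNzRingType) (M : lmodType R) (n p : nat)
  (f : {set 'I_n} -> M) : Prop :=
  forall I : {set 'I_n}, #|I| != p -> f I = 0.

Definition koszul_diff (R : comNzRingType) (M : lmodType R) (n : nat)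
  (y : 'I_n -> R) (f : {set 'I_n} -> M) : {set 'I_n} -> M :=
  fun J => \sum_(i < n | i \notin J)
     ((-1) ^+ #|[set j in J | (j < i)%N]| * y i) *: f (i |: J).

Definition koszul_exact (R : comNzRingType) (M : lmodType R) (n : nat)
  (y : 'I_n -> R) : Prop :=
  forall p : nat, forall f : {set 'I_n} -> M,
    koszul_chain p f -> koszul_diff y f =1 (fun _ => 0) ->
    exists g : {set 'I_n} -> M, koszul_chain p.+1 g /\ koszul_diff y g =1 f.

Definition taylor_spectrum (k : fieldType) (R : comAlgType k) (M : lmodType R)
  (n : nat) (y : 'I_n -> R) (a : 'I_n -> k) : Prop :=
  ~ koszul_exact M (fun i => y i - (a i)%:A).

(* Main.v *)
Require Import Defs.
From HB Require Import structures.
From mathcomp Require Import all_boot all_order all_algebra.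
From mathcomp Require Import mpoly ring.
From Stdlib Require Import Classical FunctionalExtensionality.
Import GRing.Theory.
Local Open Scope ring_scope.

Set Implicit Arguments.
Unset Strict Implicit.
Unset Printing Implicit Defensive.

(** For a Noetherian module M, Kos(y, M) is exact iff yM = M.  Degree 0 gives
one direction; conversely, Nakayama's lemma provides c in 1 + (y) killing M,
while exterior multiplication by e_i shows that y_i kills the homology, so that
1 kills the homology.  Hence a is in sigma(x, M) iff (x - a)M <> M.

If q(a) = b then q_j(x) - b_j lies in the ideal (x - a), so (x - a)M <> M
forces (q(x) - b)M <> M.  Conversely, let g generate R and write x_i = P_i(g).
If L := (q(x) - b)M <> M, the polynomials p with p(g)M contained in L form a
proper ideal, which by the weak Nullstellensatz has a zero z; put a := P(z).
This ideal contains q_j(P) - b_j, so q(a) = b; and if (x - a)M = M, it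
contains, by Nakayama's lemma, an element of 1 + (P - a), which does not vanish
at z. *)

(** * Nakayama's lemma for the ideal generated by a tuple *)

Section Nakayama.
Context {R : comNzRingType} {M : lmodType R} {n : nat} (y : 'I_n -> R).

Definition in_ideal (r : R) : Prop := exists c : 'I_n -> R, r = \sum_i c i * y i.

Definition in_ideal_module (u : M) : Prop :=
  exists f : 'I_n -> M, u = \sum_i y i *: f i.

Lemma in_ideal0 : in_ideal 0.
Proof. by exists (fun=> 0); rewrite big1 // => i _; rewrite mul0r. Qed.

Lemma in_idealD r s : in_ideal r -> in_ideal s -> in_ideal (r + s).
Proof.
move=> [c ->] [d ->]; exists (fun i => c i + d i).
by rewrite -big_split; apply: eq_bigr => i _; rewrite mulrDl.
Qed.

Lemma in_idealMl a r : in_ideal r -> in_ideal (a * r).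
Proof.
move=> [c ->]; exists (fun i => a * c i).
by rewrite mulr_sumr; apply: eq_bigr => i _; rewrite mulrA.
Qed.

Lemma in_ideal_gen i : in_ideal (y i).
Proof.
exists (fun j => (j == i)%:R); rewrite (bigD1 i) //= eqxx mul1r big1 ?addr0 //.
by move=> j /negPf ->; rewrite mul0r.
Qed.

Lemma in_ideal_moduleZ r u : in_ideal r -> in_ideal_module (r *: u).
Proof.
move=> [c ->]; exists (fun i => c i *: u).
by rewrite scaler_suml; apply: eq_bigr => i _; rewrite scalerA mulrC.
Qed.

Lemma submodule_in_ideal_module : submodule in_ideal_module.
Proof.
split=> [|u v [f ->] [g ->]|r u [f ->]].
- by exists (fun=> 0); rewrite big1 // => i _; rewrite scaler0.
- by exists (fun i => f i + g i); rewrite -big_split; apply: eq_bigr => i _;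
    rewrite scalerDr.
- exists (fun i => r *: f i); rewrite scaler_sumr; apply: eq_bigr => i _.
  by rewrite !scalerA mulrC.
Qed.

(** An induction principle: it lets an assumption yM = M be used by checking only products of a
    scalar in (y) with a vector. *)
Lemma in_ideal_moduleP (u : M) :
  in_ideal_module u ->
  forall S : M -> Prop, submodule S ->
    (forall r v, in_ideal r -> S (r *: v)) -> S u.
Proof.
move=> [f ->] S [S0 SD _] SI; apply: big_ind => // i _.
exact/SI/in_ideal_gen.
Qed.

(** Linear combinations of [s] with coefficients in [I], written recursively so that the head
    generator can be split off and eliminated. *)
Fixpoint span (I : R -> Prop) (s : seq M) (u : M) : Prop :=
  if s is v :: s' then exists2 a, I a & span I s' (u - a *: v) else u = 0.

Lemma spanD (I : R -> Prop) s : (forall a b, I a -> I b -> I (a + b)) ->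
  forall u v, span I s u -> span I s v -> span I s (u + v).
Proof.
move=> ID; elim: s => [u v /= -> ->|w s IHs u v /= [a Ia su] [b Ib sv]].
  by rewrite addr0.
exists (a + b); first exact: ID.
by rewrite scalerDl opprD addrACA; apply: IHs.
Qed.

Lemma spanZ (I J : R -> Prop) r s : (forall a, I a -> J (r * a)) ->
  forall u, span I s u -> span J s (r *: u).
Proof.
move=> IJ; elim: s => [u /= ->|w s IHs u /= [a Ia su]]; first by rewrite scaler0.
by exists (r * a); [exact: IJ | rewrite -scalerA -scalerBr; apply: IHs].
Qed.

Lemma span_sum s (c : 'I_(size s) -> R) :
  span (fun=> True) s (\sum_(i < size s) c i *: s`_i).
Proof.
elim: s c => [c|v s IHs c]; first by rewrite big_ord0.
exists (c ord0) => //; rewrite big_ord_recl /= addrC addKr; exact: IHs.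
Qed.

(* If r M lies in the span of v :: s then r M = r (y M) lies in the
   y-combinations of v :: s, so (r - a) v lies in the span of s for some a
   in (y), and then so does (r - a) r M; this eliminates the generators one at a time. *)
Lemma nakayama_span (s : seq M) (r : R) :
  (forall u : M, in_ideal_module u) ->
  in_ideal (r - 1) -> (forall u, span (fun=> True) s (r *: u)) ->
  exists2 c, in_ideal (c - 1) & forall u : M, c *: u = 0.
Proof.
move=> yM; elim: s r => [|v s IHs] r r1 rs; first by exists r.
have TD a b : True -> True -> (fun=> True) (a + b : R) by [].
have rsI u : span in_ideal (v :: s) (r *: u).
  apply: (in_ideal_moduleP (yM u) (S := fun w => span in_ideal (v :: s) (r *: w))).
    split=> [|a b|t a].
    - rewrite scaler0; elim: (v :: s) => //= w s' IH.
      by exists 0; rewrite ?scale0r ?subr0 //; apply: in_ideal0.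
    - by rewrite scalerDr; apply: (spanD in_idealD).
    - by rewrite scalerA mulrC -scalerA; apply: spanZ => b; apply: in_idealMl.
  move=> t w It; rewrite scalerA mulrC -scalerA.
  apply: (spanZ (I := fun=> True)) (rs w) => b _.
  by rewrite mulrC; apply: in_idealMl.
have [a Ia sv] := rsI v.
apply: (IHs ((r - a) * r)).
  have -> : (r - a) * r - 1 = (r - a) * (r - 1) + ((r - 1) + (-1) * a).
    by ring.
  apply: in_idealD; first exact: in_idealMl.
  by apply: in_idealD => //; apply: in_idealMl.
move=> u; have [b _ su] := rs u.
have -> : ((r - a) * r) *: u = (r - a) *: (r *: u - b *: v) + b *: (r *: v - a *: v).
  rewrite -scalerA -[r *: v - _]scalerBl scalerBr !scalerA [b * _]mulrC.
  by rewrite subrK.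
by apply: (spanD TD); [apply: (spanZ _ su) | apply: (spanZ _ sv)].
Qed.

End Nakayama.

Arguments in_ideal_module {R} M {n} y u.

Lemma nakayama (R : comNzRingType) (M : lmodType R) (n : nat) (y : 'I_n -> R) :
  noetherian_module M -> (forall u : M, in_ideal_module M y u) ->
  exists2 c, in_ideal y (c - 1) & forall u : M, c *: u = 0.
Proof.
move=> nM yM; have [|s sM] := nM (fun=> True); first by split.
apply: (nakayama_span (s := s) (r := 1)) => //.
  by rewrite subrr; apply: in_ideal0.
by move=> u; rewrite scale1r; have [/(_ I) [c ->] _] := sM u; apply: span_sum.
Qed.

(** * Koszul homology and the criterion yM = M *)

Section Koszul.
Context {R : comNzRingType} {M : lmodType R} {n : nat} (y : 'I_n -> R).
Implicit Types (f g : {set 'I_n} -> M) (I J : {set 'I_n}).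

Let below J (i : 'I_n) := #|[set j in J | (j < i)%N]|.

(** Left exterior multiplication by e_i; the sign comes from moving e_i past the smaller indices. *)
Definition koszul_wedge (i : 'I_n) f : {set 'I_n} -> M :=
  fun I => if i \in I then (-1) ^+ below I i *: f (I :\ i) else 0.

Lemma below_self J i : below (i |: J) i = below J i.
Proof.
by apply: eq_card => j; rewrite !inE; case: eqP => [->|//]; rewrite ltnn !andbF.
Qed.

Lemma below_setU1 J i l : i \notin J -> below (i |: J) l = ((i < l) + below J l)%N.
Proof.
move=> iJ; rewrite /below (cardsD1 i) !inE eqxx /=; congr (_ + _)%N.
apply: eq_card => j; rewrite !inE; case: eqP => [->|//].
by rewrite (negPf iJ).
Qed.

(** One term, with index i, survives: in the first summand if i is not in J, in the second if it is.
    In the latter case the terms with l != i cancel, because multiplication by e_i anticommutes with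
    contraction along l. *)
Lemma koszul_wedge_homotopy i f J :
  koszul_diff y (koszul_wedge i f) J + koszul_wedge i (koszul_diff y f) J
    = y i *: f J.
Proof.
rewrite /koszul_diff /koszul_wedge -/below; case: ifPn => iJ; last first.
  rewrite addr0 (bigD1 i) //= big1 ?addr0 => [|l /andP[lJ li]].
    rewrite setU11 below_self setU1K // scalerA mulrAC.
    by rewrite -/(below J i) -expr2 sqrr_sign mul1r.
  by rewrite in_setU1 eq_sym (negPf li) (negPf iJ) scaler0.
have iJ' : i \notin J :\ i by rewrite !inE eqxx.
have bJ l : below J l = ((i < l) + below (J :\ i) l)%N.
  by rewrite -{1}(setD1K iJ) below_setU1.
rewrite [X in _ + _ *: X](bigD1 i) //= setD1K // scalerDr scalerA mulrA.
rewrite -/(below (J :\ i) i) [in X in (_ ^+ X) * _]bJ ltnn add0n -expr2 sqrr_sign.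
rewrite mul1r addrCA -[RHS]addr0; congr (_ + _).
rewrite scaler_sumr [X in _ + X](eq_bigl (fun l => l \notin J)); last first.
  by move=> l; rewrite !inE; case: eqP => [->|]; rewrite ?iJ ?andbT ?andbF.
rewrite -big_split big1 //= => l lJ.
have li : l != i by apply: contraNneq lJ => ->.
rewrite in_setU1 iJ orbT setDUl.
have -> : [set l] :\ i = [set l].
  by apply/setP => j; rewrite !inE; case: eqP => [->|] //; rewrite eq_sym (negPf li).
rewrite !scalerA -/(below J l) -/(below (J :\ i) l) -scalerDl below_setU1 //.
rewrite (bJ l) mulrAC -exprD mulrA -exprD -mulrDl.
(* Exactly one of i < l and l < i holds, so the two exponents differ by one and the signs are
   opposite. *)
have -> : ((i < l) + below (J :\ i) l + ((l < i) + below J i) =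
           (below J i + below (J :\ i) l).+1)%N.
  have : ((i < l) + (l < i) = 1)%N.
    by case: ltngtP => // /val_inj e; rewrite e eqxx in li.
  by rewrite addnACA => ->; rewrite add1n addnC.
by rewrite exprS mulN1r addNr mul0r scale0r.
Qed.

Lemma koszul_exactP : noetherian_module M ->
  koszul_exact M y <-> forall u : M, in_ideal_module M y u.
Proof.
move=> nM; split=> [ex u | /(nakayama nM)[c [d cE] cM] p f fp df0].
  (* In degree 0 every chain is a cycle, and a boundary there is a combination of the y_i. *)
  pose f (I : {set 'I_n}) := if I == set0 then u else 0.
  have [|J|g [_ dg]] := ex 0%N f.
  - by move=> I; rewrite cards_eq0 /f => /negPf ->.
  - rewrite /koszul_diff big1 // => i _; rewrite /f; case: eqP => [e|_];
      rewrite ?scaler0 //.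
    by have := setU11 i J; rewrite e inE.
  - have := dg set0; rewrite /f eqxx => <-.
    eexists; apply: eq_big => [i|i _]; first by rewrite inE.
    by rewrite mulrC -scalerA.
(* Since 1 + sum_i d_i y_i kills M, the homotopy makes the boundary of this chain equal to - sum_i
   d_i y_i f = f. *)
exists (fun J => - \sum_i d i *: koszul_wedge i f J); split=> [I IE|J].
  rewrite big1 ?oppr0 // => i _; rewrite /koszul_wedge; case: ifP => iI.
    rewrite fp ?scaler0 //; move: IE; rewrite (cardsD1 i) iI add1n eqSS //.
  by rewrite scaler0.
have -> : koszul_diff y (fun J => - \sum_i d i *: koszul_wedge i f J) J =
    - \sum_i d i *: koszul_diff y (koszul_wedge i f) J.
  rewrite /koszul_diff; under eq_bigr do rewrite scalerN scaler_sumr.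
  rewrite sumrN; congr (- _); rewrite exchange_big /=; apply: eq_bigr => i _.
  by rewrite scaler_sumr; apply: eq_bigr => l _; rewrite !scalerA mulrC.
have dw i : koszul_diff y (koszul_wedge i f) J = y i *: f J.
  rewrite -koszul_wedge_homotopy /koszul_wedge.
  by case: ifP => _; rewrite ?df0 ?scaler0 addr0.
under eq_bigr do rewrite dw scalerA.
by rewrite -scaler_suml -cE scalerBl cM scale1r sub0r opprK.
Qed.

End Koszul.

(** * Ideals and substitution into multivariate polynomials *)

Definition ideal (R : comNzRingType) (I : R -> Prop) : Prop :=
  [/\ I 0, forall a b, I a -> I b -> I (a + b) & forall a b, I b -> I (a * b)].

Lemma rmorph_mmap n (R : nzRingType) (S T : comNzRingType)
    (phi : {rmorphism S -> T}) (f : R -> S) (h : 'I_n -> S) p :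
  phi (mmap f h p) = mmap (phi \o f) (phi \o h) p.
Proof.
rewrite /mmap rmorph_sum; apply: eq_bigr => m _; rewrite rmorphM; congr (_ * _).
by rewrite /mmap1 rmorph_prod; apply: eq_bigr => i _; rewrite rmorphXn.
Qed.

Lemma eq_mmap n (R S : nzRingType) (f f' : R -> S) (h h' : 'I_n -> S) :
  f =1 f' -> h =1 h' -> mmap f h =1 mmap f' h'.
Proof.
move=> ef eh p; apply: eq_bigr => m _; rewrite ef; congr (_ * _).
exact: mmap1_eq.
Qed.

Lemma mmap_id n (R : nzRingType) (p : {mpoly R[n]}) :
  mmap (@mpolyC n R) (fun i => 'X_i) p = p.
Proof.
rewrite [RHS]mpolyE; apply: eq_bigr => m _.
by rewrite mmap1_id mul_mpolyC.
Qed.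

(** * Linear changes of variables and leading coefficients *)

(* [shear v] is the linear change of variables X_i = X_i' + v_i T, for i < n,
   and X_n = v_n T, read as a polynomial in T. *)
Section Shear.
Context (k : fieldType) (n : nat) (v : 'I_n.+1 -> k).

Let shear_var (i : 'I_n.+1) : {poly {mpoly k[n]}} :=
  (if unlift ord_max i is Some j then ('X_j)%:P else 0) + ((v i)%:MP)%:P * 'X.

Definition shear : {mpoly k[n.+1]} -> {poly {mpoly k[n]}} :=
  mmap (polyC \o @mpolyC n k) shear_var.

HB.instance Definition _ := GRing.RMorphism.on shear.

(** Solving for the new variables gives T = X_n / v_n and X_j' = X_j - (v_j / v_n) X_n. *)
Let unshear_var (j : 'I_n) : {mpoly k[n.+1]} :=
  'X_(lift ord_max j) - (v (lift ord_max j) / v ord_max)%:MP * 'X_ord_max.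

Definition unshear : {poly {mpoly k[n]}} -> {mpoly k[n.+1]} :=
  horner_eval ((v ord_max)^-1%:MP * 'X_ord_max)
    \o map_poly (mmap (@mpolyC n.+1 k) unshear_var).

HB.instance Definition _ := GRing.RMorphism.on unshear.

Hypothesis v_neq0 : v ord_max != 0.

Lemma shearK : cancel shear unshear.
Proof.
move=> p; rewrite /shear rmorph_mmap -[RHS]mmap_id; apply: eq_mmap => [c|i] /=.
  by rewrite /unshear /= map_polyC /horner_eval hornerC [LHS]mmapC.
rewrite /unshear /shear_var rmorphD rmorphM /= !map_polyC /= map_polyX /horner_eval.
rewrite hornerX hornerC mmapC /= mulrA -mpolyCM; case: unliftP => [j ->|->].
  by rewrite map_polyC hornerC /= mmapX mmap1U subrK.
by rewrite map_poly0 horner0 add0r divff // mpolyC1 mul1r.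
Qed.

Lemma map_shear (a : 'I_n -> k) (t : k) p :
  (map_poly (meval a) (shear p)).[t] =
  p.@[fun i => (if unlift ord_max i is Some j then a j else 0) + v i * t].
Proof.
rewrite -/(horner_eval t _).
rewrite -[LHS]/((horner_eval t \o map_poly (meval a)) (shear p)).
rewrite /shear rmorph_mmap; apply: eq_mmap => [c|i] /=.
  by rewrite map_polyC /= /horner_eval hornerC mevalC.
rewrite /shear_var rmorphD rmorphM /= !map_polyC /= map_polyX /horner_eval.
rewrite hornerD hornerM hornerX hornerC mevalC; congr (_ + _).
case: unlift => [j|]; first by rewrite map_polyC hornerC /= mevalXU.
by rewrite map_poly0 horner0.
Qed.

(** Only a bound on the degree: c may be 0, as some v_i may vanish. *)
Let top d (c : k) (s : {poly {mpoly k[n]}}) := (size s <= d.+1)%N /\ s`_d = c%:MP.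

Let topM d d' c c' s s' :
  top d c s -> top d' c' s' -> top (d + d') (c * c') (s * s').
Proof.
move=> [sd cd] [sd' cd']; split.
  apply: (leq_trans (size_polyMleq _ _)); have := leq_add sd sd'.
  by rewrite addSn addnS; case: (size s + size s')%N.
rewrite coefM.
have dlt : (d < (d + d').+1)%N by rewrite ltnS leq_addr.
rewrite (bigD1 (Ordinal dlt)) //= addKn cd cd' mpolyCM big1 ?addr0 // => j.
rewrite -val_eqE /= neq_ltn => /orP[jd|dj].
  rewrite [s'`_ _]nth_default ?mulr0 //; apply: (leq_trans sd').
  by rewrite ltn_subRL ltn_add2r.
by rewrite nth_default ?mul0r // (leq_trans sd).
Qed.

Let topX d c s e : top d c s -> top (d * e) (c ^+ e) (s ^+ e).
Proof.
move=> ts; elim: e => [|e IH]; first by rewrite muln0 !expr0 /top size_poly1 coef1.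
by rewrite mulnS !exprS; apply: topM.
Qed.

Let top_shear_var i : top 1 (v i) (shear_var i).
Proof.
rewrite /top /shear_var; split.
  apply: (leq_trans (size_polyD _ _)); rewrite geq_max; apply/andP; split.
    case: unlift => [j|]; last by rewrite size_poly0.
    by rewrite (leq_trans (size_polyC_leq1 _)).
  apply: (leq_trans (size_polyMleq _ _)); rewrite size_polyX addn2 /=.
  by rewrite ltnS size_polyC_leq1.
rewrite coefD coefMX coefC /=; case: unlift => [j|]; first by rewrite coefC add0r.
by rewrite coef0 add0r.
Qed.

Let top_shear_mnm m : top (mdeg m) (\prod_i v i ^+ m i) (mmap1 shear_var m).
Proof.
rewrite mdegE /mmap1.
apply: (big_rec3 (fun d c s => top d c s)).
  by rewrite /top size_poly1 coef1.
move=> i d c s _ tds; apply: topM => //.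
by have := topX (m i) (top_shear_var i); rewrite mul1n.
Qed.

(** The homogeneous component of highest degree; [msize] is the degree plus one. *)
Definition top_form (p : {mpoly k[n.+1]}) : {mpoly k[n.+1]} :=
  \sum_(m <- msupp p | mdeg m == (msize p).-1) p@_m *: 'X_[m].

Lemma top_form_neq0 p : p != 0 -> top_form p != 0.
Proof.
move=> p0; have pl := mlead_supp p0; apply: contraNneq (p0).
move=> /(congr1 (mcoeff (mlead p))).
rewrite raddf_sum /= mcoeff0 -big_filter (bigD1_seq (mlead p)) /=.
- rewrite mcoeffZ mcoeffX eqxx mulr1 big1 ?addr0 => [/eqP|m ml].
    by rewrite mleadc_eq0.
  by rewrite mcoeffZ mcoeffX (negPf ml) mulr0.
- by rewrite mem_filter pl -mlead_deg // eqxx.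
- by rewrite filter_uniq ?msupp_uniq.
Qed.

Lemma size_shear p : (size (shear p) <= (msize p).-1.+1)%N.
Proof.
apply: (leq_trans (size_sum _ _ _)); apply/bigmax_leqP_seq => m mp _.
have [sm _] := top_shear_mnm m.
rewrite /= mul_polyC (leq_trans (size_scale_leq _ _)) // (leq_trans sm) // ltnS.
by have := msize_mdeg_lt mp; case: (msize p).
Qed.

(** Monomials of lower degree do not reach this power of T, and one of top degree contributes its
    value at v. *)
Lemma coef_shear p : (shear p)`_(msize p).-1 = ((top_form p).@[v])%:MP.
Proof.
rewrite /shear /mmap coef_sum /top_form [meval _ _]raddf_sum /= [RHS]raddf_sum /=.
rewrite [RHS]big_mkcond /=.
apply: eq_big_seq => m mp; have [sm cm] := top_shear_mnm m.
rewrite /= mul_polyC coefZ; case: eqP => [<-|/eqP dm].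
  by rewrite cm mevalZ mevalX mpolyCM.
rewrite nth_default ?mulr0 // (leq_trans sm) // ltn_neqAle dm.
by have := msize_mdeg_lt mp; case: (msize p).
Qed.

End Shear.

(** * Zeros of polynomials and the weak Nullstellensatz *)

Lemma mpoly0_const (R : nzRingType) (p : {mpoly R[0]}) : p = (p.@[fun=> 0])%:MP.
Proof.
rewrite -{1}[p]mmap_id mevalE /mmap raddf_sum; apply: eq_bigr => m _ /=.
by rewrite /mmap1 !big_ord0 !mulr1.
Qed.

Lemma mpoly_nonzero_value (k : closedFieldType) n (p : {mpoly k[n]}) :
  p != 0 -> exists a, p.@[a] != 0.
Proof.
elim: n p => [|n IHn] p p0.
  exists (fun=> 0); apply: contraNneq p0 => p0.
  by rewrite [p]mpoly0_const p0 mpolyC0.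
(* For this v the shear merely singles out the last variable; the induction hypothesis then applies
   to the leading coefficient. *)
pose v (i : 'I_n.+1) : k := (i == ord_max)%:R.
have v0 : v ord_max != 0 by rewrite /v eqxx oner_eq0.
have : shear v p != 0 by apply: contra_neq p0 => e; rewrite -(shearK v0 p) e rmorph0.
rewrite -lead_coef_eq0 => /IHn[a a0].
have /closed_nonrootP[t] : map_poly (meval a) (shear v p) != 0.
  apply: contraNneq a0 => /(congr1 (fun s : {poly k} => s`_(size (shear v p)).-1)).
  by rewrite coef_map coef0 => /eqP.
by rewrite /root map_shear => ?; eexists; eassumption.
Qed.

(* [map_resultant] of mxpoly only covers morphisms out of a polynomial ring. *)
Lemma rmorph_resultant (A B : nzRingType) (phi : {rmorphism A -> B}) p q :
  phi (lead_coef p) != 0 -> phi (lead_coef q) != 0 ->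
  phi (resultant p q) = resultant (map_poly phi p) (map_poly phi q).
Proof.
move=> p0 q0; rewrite /resultant -det_map_mx /Sylvester_mx.
rewrite !size_map_poly_id0 // map_col_mx; congr (\det (col_mx _ _)).
  by apply: map_lin1_mx => r; rewrite map_poly_rV rmorphM /= map_rVpoly.
by apply: map_lin1_mx => r; rewrite map_poly_rV rmorphM /= map_rVpoly.
Qed.

(** By Euclidean division, a nonzero element of least degree divides all of K; it is not constant,
    as K is proper, so any root of it will do. *)
Lemma poly_ideal_root (k : closedFieldType) (K : {poly k} -> Prop) :
  ideal K -> ~ K 1 -> exists t, forall s, K s -> s.[t] = 0.
Proof.
move=> [K0 KD KM] K1.
case: (classic (exists d, exists2 s, K s & s != 0 /\ size s = d)) => [ex|nex];
  last first.
  (* Here K has no nonzero element, so any point will do. *)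
  exists 0 => s Ks; have [->|s0] := eqVneq s 0; first by rewrite horner0.
  by case: nex; exists (size s), s.
have [u Ku [u0 umin]] : exists2 u, K u &
    u != 0 /\ forall s, K s -> s != 0 -> (size u <= size s)%N.
  case: ex => d; elim/ltn_ind: d => d IH [s Ks [s0 sd]].
  case: (classic (exists2 t, K t & t != 0 /\ (size t < d)%N)) => [[t Kt [t0 td]]|nt].
    by apply: (IH _ td); exists t.
  exists s => //; split=> // t Kt t0; rewrite sd leqNgt; apply/negP => td.
  by apply: nt; exists t.
have /closed_rootP[t ut] : size u != 1%N.
  apply/negP => /size_poly1P[c c0 uc]; apply: K1.
  by rewrite -(_ : c^-1%:P * u = 1); [apply: KM | rewrite uc -polyCM mulVf].
exists t => s Ks; have us : u %| s.
  rewrite /dvdp; apply: contraT => r0.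
  suff /umin /(_ r0) : K (s %% u) by rewrite leqNgt ltn_modp u0.
  have -> : s %% u = s + - (s %/ u) * u.
    by rewrite {2}(divp_eq s u) mulNr addrAC subrr add0r.
  by apply: KD => //; apply: KM.
by apply/rootP; have /dvdpP[w ->] := us; rewrite rootM ut orbT.
Qed.

(* After a linear change of variables, I contains an f whose leading coefficient
   in the last variable T is constant.  Let a' be a common zero of the
   T-free elements.  If some s in I specialised to 1 at a', the resultant of
   s + T^e f and f would be T-free, in I, and nonzero at a'. *)
Lemma weak_nullstellensatz (k : closedFieldType) n (I : {mpoly k[n]} -> Prop) :
  ideal I -> ~ I 1 -> exists a, forall p, I p -> p.@[a] = 0.
Proof.
elim: n I => [|n IHn] I idI I1; have [I0 ID IM] := idI.
  exists (fun=> 0) => p Ip; apply/eqP; apply: contra_notT I1 => p0.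
  rewrite (_ : 1 = (p.@[fun=> 0])^-1%:MP * p); first exact: IM.
  by rewrite {2}[p]mpoly0_const -mpolyCM mulVf // mpolyC1.
case: (classic (exists2 p, I p & p != 0)) => [[p Ip p0]|nI]; last first.
  exists (fun=> 0) => p Ip; have [->|p0] := eqVneq p 0; first by rewrite meval0.
  by case: nI; exists p.
(* The factor X_n also secures v_n != 0, which makes the shear invertible. *)
have [v] : exists v, (top_form p * 'X_ord_max).@[v] != 0.
  apply: mpoly_nonzero_value; rewrite mulf_neq0 ?top_form_neq0 //.
  by rewrite -msupp_eq0 msuppX.
rewrite mevalM mevalXU mulf_eq0 negb_or => /andP[top_v v0].
pose f := shear v p; pose J s := I (unshear v s).
have IJ r : I r -> J (shear v r) by rewrite /J shearK.
have Jf : J f by apply: IJ.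
have JD s t : J s -> J t -> J (s + t) by rewrite /J rmorphD; apply: ID.
have JM s t : J t -> J (s * t) by rewrite /J rmorphM; apply: IM.
have J0 : J 0 by rewrite /J rmorph0.
have J1 : ~ J 1 by rewrite /J rmorph1.
clearbody J.
have topC : (top_form p).@[v]%:MP != 0 :> {mpoly k[n]} by rewrite mpolyC_eq0.
have sf : size f = (msize p).-1.+1.
  apply/eqP; rewrite eqn_leq size_shear ltnNge; apply: contraNN topC => sf.
  by rewrite -coef_shear nth_default.
have lf : lead_coef f = ((top_form p).@[v])%:MP.
  by rewrite lead_coefE sf /= coef_shear.
(* A constant f would be a unit in the proper ideal J. *)
have f_gt1 : (1 < size f)%N.
  rewrite ltn_neqAle sf andbT eq_sym -sf; apply: contra_notN J1 => /eqP f1.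
  rewrite (_ : 1 = ((top_form p).@[v])^-1%:MP%:P * f); first exact: JM.
  rewrite [f]size1_polyC ?f1 // -polyCM; congr _%:P.
  by move: lf; rewrite lead_coefE f1 => ->; rewrite -mpolyCM mulVf.
have [||a' a'J] := IHn (fun c => J c%:P).
- split=> [|c d Jc Jd|c d Jd]; first by rewrite polyC0.
    by rewrite polyCD; apply: JD.
  by rewrite polyCM; apply: JM.
- by rewrite polyC1.
pose ev := map_poly (meval a').
have evl : meval a' (lead_coef f) != 0 by rewrite lf mevalC.
(* Evaluation at a' maps J onto an ideal of k[T]; a root t of it gives the missing coordinate. *)
have [|K1|t tJ] := poly_ideal_root (K := fun r => exists2 s, J s & ev s = r).
- split=> [|_ _ [s Js <-] [t Jt <-]|r _ [s Js <-]].
  + by exists 0; [exact: J0 | exact: rmorph0].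
  + by exists (s + t); [exact: JD | rewrite /ev rmorphD].
  + exists (map_poly (@mpolyC n k) r * s); first exact: JM.
    rewrite /ev rmorphM; congr (_ * _); rewrite /= -map_poly_comp map_poly_id // => c _.
    by rewrite /= mevalC.
- have [s Js s1] := K1.
  (* Adding T^e f to s makes the leading coefficient a constant, so that taking
     the resultant commutes with evaluation at a'. *)
  pose e := size s; pose g := s + 'X^e * f.
  have Jg : J g by apply: JD Js _; apply: JM Jf.
  have f0 : f != 0 by rewrite -size_poly_gt0 (ltn_trans _ f_gt1).
  have sXf : (size s < size ('X^e * f)%R)%N.
    by rewrite mulrC size_mulXn // -[X in (X < _)%N]addn0 ltn_add2l (ltn_trans _ f_gt1).
  have lg : lead_coef g = lead_coef f.
    by rewrite /g addrC lead_coefDl // lead_coef_monicM ?monicXn.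
  have g_gt1 : (1 < size g)%N.
    rewrite /g addrC size_polyDl // mulrC size_mulXn // (leq_trans f_gt1) //.
    exact: leq_addl.
  have [[u w] _ res] := resultant_in_ideal g_gt1 f_gt1.
  have Jres : J (resultant g f)%:P.
    by rewrite res; apply: JD; [apply: JM Jg | apply: JM Jf].
  have := a'J _ Jres; rewrite rmorph_resultant ?lg // => /eqP.
  rewrite resultant_eq0 -/(ev g) -/(ev f) ltnNge; apply/negP; rewrite negbK.
  (* Modulo [ev f] this is 1, so [ev g] and [ev f] are coprime and their resultant cannot vanish. *)
  have -> : ev g = 'X^e * ev f + 1.
    by rewrite -s1 addrC /ev rmorphD rmorphM /= map_polyXn.
  have := coprimep1 (ev f); rewrite -(coprimep_addl_mul 'X^e) coprimep_sym.
  by rewrite coprimep_def => /eqP ->.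
exists (fun i => (if unlift ord_max i is Some j then a' j else 0) + v i * t) => r Ir.
by rewrite -map_shear; apply: tJ; exists (shear v r); [exact: IJ | exact: erefl].
Qed.

(** * Polynomial values in R and the spectral mapping theorem *)

HB.instance Definition _ (k : fieldType) (R : comAlgType k) (n : nat)
  (x : 'I_n -> R) := GRing.RMorphism.copy (peval x) (mmap (in_alg R) x).

Section PolynomialValues.
Context (k : fieldType) (R : comAlgType k) (n : nat) (x : 'I_n -> R).

Lemma pevalC c : peval x c%:MP = c%:A.
Proof. exact: mmapC. Qed.

Lemma peval_comp l (P : 'I_l -> {mpoly k[n]}) (p : {mpoly k[l]}) :
  peval x (mmap (@mpolyC n k) P p) = peval (fun i => peval x (P i)) p.
Proof. by rewrite rmorph_mmap; apply: eq_mmap => // c; apply: pevalC. Qed.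

(** Modulo (x - a) each x_i equals a_i, and congruence to a scalar, the relation [K], respects sums
    and products. *)
Lemma in_ideal_peval (a : 'I_n -> k) (p : {mpoly k[n]}) :
  in_ideal (fun i => x i - (a i)%:A) (peval x p - (p.@[a])%:A).
Proof.
pose K u (b : k) := in_ideal (fun i => x i - (a i)%:A) (u - b%:A).
have KD u v b c : K u b -> K v c -> K (u + v) (b + c).
  by move=> Ku Kv; rewrite /K scalerDl opprD addrACA; apply: in_idealD.
have KM u v b c : K u b -> K v c -> K (u * v) (b * c).
  move=> Ku Kv; rewrite /K.
  have -> : (b * c)%:A = b%:A * c%:A :> R by rewrite -scalerAl mul1r scalerA.
  have -> : u * v - b%:A * c%:A = u * (v - c%:A) + c%:A * (u - b%:A) by ring.
  by apply: in_idealD; apply: in_idealMl.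
have KC c : K c%:A c by rewrite /K subrr; apply: in_ideal0.
have K1 : K 1 1 by rewrite -[X in K X]scale1r.
have K0 : K 0 0 by rewrite -[X in K X](scale0r 1).
apply: (big_rec2 K) => // m u b _ Kub; apply: KD => //; apply: (KM); first exact: KC.
rewrite /mmap1; apply: (big_rec2 K) => // i v c _ Kvc; apply: (KM) => //.
elim: (m i) => [|e IHe]; rewrite ?expr0 // !exprS; apply: (KM) => //.
exact: in_ideal_gen.
Qed.

End PolynomialValues.

Theorem theorem2p13 (k : closedFieldType) (R : comAlgType k) (M : lmodType R)
  (n m : nat) (x : 'I_n -> R) (q : 'I_m -> {mpoly k[n]}) :
  fg_algebra R -> noetherian_module M ->
  forall b : 'I_m -> k,
    taylor_spectrum M (fun j => peval x (q j)) b <->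
    exists a : 'I_n -> k, taylor_spectrum M x a /\ (fun j => (q j).@[a]) = b.
Proof.
move=> [N [g gR]] nM b; rewrite /taylor_spectrum.
set y := fun j => peval x (q j) - (b j)%:A.
split=> [nex|[a [nex qa]]]; last first.
  move=> /(koszul_exactP _ nM) yM; apply: nex; apply/(koszul_exactP _ nM) => u.
  have [S0 SD _] := submodule_in_ideal_module (M := M) (fun i => x i - (a i)%:A).
  have [f ->] := yM u; apply: big_ind => // j _.
  by apply: in_ideal_moduleZ; rewrite /y -qa; apply: in_ideal_peval.
have [P xP] := fin_all_exists (fun i => gR (x i)).
have [S0 SD SZ] := submodule_in_ideal_module (M := M) y.
(* The annihilator of M / yM, pulled back along [peval g]. *)
pose I (p : {mpoly k[N]}) := forall u, in_ideal_module M y (peval g p *: u).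
have [|I1|a aI] := weak_nullstellensatz (I := I).
- split=> [u|p r Ip Ir u|p r Ir u].
  + by rewrite rmorph0 scale0r.
  + by rewrite rmorphD scalerDl; apply: SD.
  + by rewrite rmorphM -scalerA; apply: SZ.
- apply: nex; apply/(koszul_exactP _ nM) => u.
  by have := I1 u; rewrite rmorph1 scale1r.
exists (fun i => (P i).@[a]); split; last first.
  apply: functional_extensionality => j; apply/eqP; rewrite -subr_eq0; apply/eqP.
  (* [peval g] sends this polynomial to y_j, so it lies in [I]. *)
  rewrite -[RHS](aI (mmap (@mpolyC N k) P (q j) - (b j)%:MP)).
    rewrite mevalB mevalC rmorph_mmap; congr (_ - _).
    by apply: eq_mmap => // c; rewrite /= mevalC.
  move=> u; rewrite rmorphB /= peval_comp pevalC; apply: in_ideal_moduleZ.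
  have -> : peval (fun i => peval g (P i)) (q j) = peval x (q j).
    by apply: eq_mmap => // i.
  exact: (in_ideal_gen y).
move=> /(koszul_exactP _ nM)/(nakayama nM)[c [d cE] cM].
have [D dD] := fin_all_exists (fun i => gR (d i)).
(* A lift of c to a polynomial: it lies in [I] because c kills M, yet its value at a is 1. *)
pose rho := 1 + \sum_i D i * (P i - ((P i).@[a])%:MP).
have rhoE : peval g rho = c.
  rewrite rmorphD rmorph1 rmorph_sum -[RHS](subrK 1) cE addrC; congr (_ + _).
  by apply: eq_bigr => i _; rewrite rmorphM rmorphB /= pevalC dD xP.
have /eqP : rho.@[a] = 0 by apply: aI => u; rewrite rhoE cM.
rewrite mevalD meval1 raddf_sum big1 ?addr0 ?oner_eq0 // => i _.
by rewrite /= mevalM mevalB mevalC subrr mulr0.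
Qed.
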